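(* Let $M=(V,d)$ be a finite metric space in which all distances are integers in $\{0,1,2\}$, with $|V|\geq 3$. Then $$\ell^*(M)+\textsc{up}(M)\geq |V|.$$
   Context: For a metric space $M=(V,d)$ and distinct points $x,y\in V$, the line generated by $x,y$ is $\overline{xy}^M=\{z\in V: d(x,y)=d(x,z)+d(z,y)\ \text{or}\ d(x,y)=|d(x,z)-d(z,y)|\}$. A line is universal if it equals $V$, and then the 2-set $\{x,y\}$ is a universal pair. $\ell^*(M)$ is the number of distinct non-universal lines of $M$, and $\textsc{up}(M)$ is the number of universal pairs (unordered pairs $\{x,y\}$ of distinct points with $\overline{xy}^M=V$). *)

(* Defs.v *)
From HB Require Import structures.
From mathcomp Require Import all_boot all_order all_algebra.
From mathcomp Require Import reals topology_structure uniform_structure.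
From mathcomp Require Import pseudometric_structure metric_structure.

Set Implicit Arguments.
Unset Strict Implicit.
Unset Printing Implicit Defensive.

Import Order.TTheory GRing.Theory Num.Theory.
Local Open Scope ring_scope.

#[short(type="finMetricType")]
HB.structure Definition FinMetric (R : numDomainType) :=
  { M of Finite M & Metric R M }.

Section Lines.
Context {R : realType} (M : finMetricType R).
Implicit Types x y z : M.

(* Only meaningful for x != y: the uses below all impose distinctness. *)
Definition line x y : {set M} :=
  [set z | (mdist x y == mdist x z + mdist z y)
        || (mdist x y == `|mdist x z - mdist z y|)].

Definition lines : {set {set M}} :=
  [set line p.1 p.2 | p : M * M & p.1 != p.2].

Definition nonuniversal_lines : {set {set M}} :=
  [set L in lines | L != [set: M]].

(* A pair is a 2-element set, so {x, y} and {y, x} count once. *)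
Definition universal_pairs : {set {set M}} :=
  [set [set p.1; p.2] | p : M * M & (p.1 != p.2) && (line p.1 p.2 == [set: M])].

Definition num_nonuniversal_lines : nat := #|nonuniversal_lines|.

Definition num_universal_pairs : nat := #|universal_pairs|.

End Lines.

(* Main.v *)
Require Import Defs.
From mathcomp Require Import all_boot all_order all_algebra.
From mathcomp Require Import reals metric_structure.

(* Call x, y adjacent when d(x,y) = 1. The line of an edge xy is {x,y} together
   with the symmetric difference of the neighbourhoods; that of a nonedge xy is
   {x,y} together with the common neighbours. Classify pairs by the line they
   generate, each universal pair forming its own class: we need at least n classes.

   If y, z are nonadjacent twins, deleting z loses at least one class: either
   some x is adjacent to neither, and the line zx contains z but not y, or yz is
   universal. So assume that there are no such twins. Two edges, or two nonedges,
   in the same class are then disjoint, while an edge and a nonedge in the same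
   class always meet. With fewer than n classes, the n(n-1) ordered pairs force
   a class of at least n ordered pairs. It contains both an edge ab and a
   nonedge ac, for otherwise it would be a matching inside its line, a proper
   subset of the n points.
   The meeting condition confines a mixed class to {ab, ac, cd, bd} for some d,
   so n <= 8, and for n >= 5 the vertices a, b, c, d form an induced 4-cycle.
   For n <= 6 it remains to inspect the graphs on n vertices (containing that
   4-cycle if n >= 5). For n = 7 the class is all of {ab, ac, cd, bd}, and every
   other vertex sees none of the 4-cycle, or just a and b, or just c and d.
   For n = 8 every class has this form; but the class of ad cannot. *)

Set Implicit Arguments.
Unset Strict Implicit.
Unset Printing Implicit Defensive.

(** * Comparing numbers of distinct values *)

(** Choose a preimage in [A] for each value of [f]: its image under [g] determines that value, so
    distinct values of [f] give distinct values of [g]. *)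
Lemma leq_card_imset_factor (aT rT rT' : finType) (f : aT -> rT) (g : aT -> rT')
    (A : {set aT}) :
  {in A &, forall x y, g x = g y -> f x = f y} -> #|f @: A| <= #|g @: A|.
Proof.
move=> gf; have [->|[x0 _]] := set_0Vmem A; first by rewrite imset0 cards0.
pose rep k := odflt x0 [pick x in A | f x == k].
have repP k : k \in f @: A -> rep k \in A /\ f (rep k) = k.
  case/imsetP=> x xA ->; rewrite /rep; case: pickP => [y /andP[yA /eqP]|/(_ x)] //.
  by rewrite xA eqxx.
rewrite -(card_in_imset (f := g \o rep)); last first.
  move=> k l /repP[kA {2}<-] /repP[lA {2}<-] /= /gf; exact.
by apply: subset_leq_card; apply/subsetP=> _ /imsetP[k /repP[kA _] ->]; exact: imset_f.
Qed.

Lemma size_undup_map_factor (A B C : eqType) (f : A -> B) (g : A -> C) (s : seq A) :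
  {in s &, forall x y, g x = g y -> f x = f y} ->
  size (undup (map f s)) <= size (undup (map g s)).
Proof.
elim: s => //= x s IH gf; have {}IH := IH _.
have le : size (undup (map f s)) <= size (undup (map g s)).
  by apply: IH => y z ys zs; apply: gf; rewrite inE ?ys ?zs orbT.
case: ifPn => fx; case: ifPn => gx //=; first exact: leqW.
case/mapP: gx => y ys gxy; case/negP: fx; apply/mapP; exists y => //.
by apply: gf; rewrite ?inE ?eqxx ?ys ?orbT.
Qed.

(* A graph on 0, ..., n-1 is encoded by its rows: the i-th one tells the
   neighbours of i among 0, ..., i-1. *)
Definition adj (g : seq (seq bool)) i j :=
  if i < j then nth false (nth [::] g j) i else nth false (nth [::] g i) j.

Definition mask (g : seq (seq bool)) i j :=
  [seq [|| k == i, k == j |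
        if adj g i j then adj g i k (+) adj g j k else adj g i k && adj g j k]
  | k <- iota 0 (size g)].

(** Index pairs are increasing, so the pair itself can stand for the 2-set that [key] records for a
    universal line. *)
Definition mask_key g (p : nat * nat) :=
  (mask g p.1 p.2, if all id (mask g p.1 p.2) then Some p else None).

Definition index_pairs n := [seq (i, j) | j <- iota 0 n, i <- iota 0 j].

Definition enough_lines g :=
  size g <= size (undup [seq mask_key g p | p <- index_pairs (size g)]).

Fixpoint bitseqs n : seq (seq bool) :=
  if n is n'.+1 then [seq b :: r | b <- [:: true; false], r <- bitseqs n']
  else [:: [::]].

Definition graphs (rows : seq (seq (seq bool))) :=
  foldr (fun rs gs => [seq r :: g | r <- rs, g <- gs]) [:: [::]] rows.

Definition free_rows m n := [seq bitseqs i | i <- iota m n].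

(** The 4-cycle 0-1-2-3-0, in the order [a], [b], [c], [d] of [square]. *)
Definition square_rows : seq (seq (seq bool)) :=
  [:: [:: [::]]; [:: [:: true]]; [:: [:: false; true]];
      [:: [:: true; false; true]]].

(** The adjacencies to 0, 1, 2, 3 left to a further vertex by [outside_full_square]. *)
Definition outside_square : seq (seq bool) :=
  [:: [:: false; false; false; false]; [:: true; true; false; false];
      [:: false; false; true; true]].

Definition outside_rows i : seq (seq bool) :=
  [seq r ++ r' | r <- outside_square, r' <- bitseqs (i - 4)].

(** * Exhaustive checks on small graphs *)

Lemma enough_lines_small n : 3 <= n <= 4 ->
  all enough_lines (graphs (free_rows 0 n)).
Proof. by move: n => [|[|[|[|[|]]]]] // _; vm_compute. Qed.

Lemma enough_lines_square n : 5 <= n <= 6 ->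
  all enough_lines (graphs (square_rows ++ free_rows 4 (n - 4))).
Proof. by move: n => [|[|[|[|[|[|[|]]]]]]] // _; vm_compute. Qed.

Lemma enough_lines_full_square :
  all enough_lines (graphs (square_rows ++ [seq outside_rows i | i <- iota 4 3])).
Proof. by vm_compute. Qed.

Lemma mem_bitseqs r : r \in bitseqs (size r).
Proof.
by elim: r => // b r IH; apply: allpairs_f => //; case: b.
Qed.

Lemma mem_graphs g rows : size g = size rows ->
  (forall i, i < size rows -> nth [::] g i \in nth [::] rows i) -> g \in graphs rows.
Proof.
elim: rows g => [|rs rows IH] [|r g] //= [eqs] h.
apply: allpairs_f; first exact: (h 0).
by apply: IH => // i; apply: (h i.+1).
Qed.

(** * Lines and classes of pairs in a graph *)

Section Graph.

Context (T : finType) (e : rel T) (e_sym : symmetric e).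
Implicit Types (S : {set T}) (a b c d x y z : T) (p q : T * T).

Definition on_line x y z :=
  [|| z == x, z == y | if e x y then e x z (+) e y z else e x z && e y z].

Definition line_in S x y := [set z in S | on_line x y z].

(* The second component tells universal pairs apart, so that the number of keys
   counts the nonuniversal lines once and every universal pair separately. *)
Definition key S p :=
  (line_in S p.1 p.2,
   if line_in S p.1 p.2 == S then [set p.1; p.2] else set0).

Definition pairs S := [set p : T * T | [&& p.1 \in S, p.2 \in S & p.1 != p.2]].

Definition keys S := key S @: pairs S.

Definition fiber S k := [set p in pairs S | key S p == k].

Definition twin_free S := forall y z, y \in S -> z \in S -> y != z -> ~~ e y z ->
  exists v, [/\ v \in S, v != y, v != z & e v y != e v z].

Definition same_line S a b c d := {in S, on_line a b =1 on_line c d}.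

Lemma on_lineC x y z : on_line x y z = on_line y x z.
Proof. by rewrite /on_line e_sym orbCA addbC andbC. Qed.

Lemma same_lineCl S a b c d : same_line S a b c d -> same_line S b a c d.
Proof. by move=> h z zS; rewrite on_lineC h. Qed.

Lemma same_lineCr S a b c d : same_line S a b c d -> same_line S a b d c.
Proof. by move=> h z zS; rewrite h // on_lineC. Qed.

Lemma same_line_trans S a b c d x y :
  same_line S a b c d -> same_line S c d x y -> same_line S a b x y.
Proof. by move=> h k z zS; rewrite h // k. Qed.

Lemma key_same_line S p q : key S p = key S q -> same_line S p.1 p.2 q.1 q.2.
Proof. by case=> /setP h _ z zS; have := h z; rewrite !inE zS. Qed.

Lemma key_swap S a b : key S (a, b) = key S (b, a).
Proof.
have h : line_in S a b = line_in S b a.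
  by apply/setP=> z; rewrite !inE on_lineC.
by rewrite /key /= h setUC.
Qed.

Lemma fiber_swap S k a b : (a, b) \in fiber S k -> (b, a) \in fiber S k.
Proof.
rewrite !inE /= => /andP[/and3P[-> -> ab]] /eqP <-.
by rewrite key_swap eq_sym ab /=.
Qed.

Lemma card_pairs S : #|pairs S| = #|S| * #|S|.-1.
Proof.
rewrite -sum1_card (eq_bigl (fun p => (p.1 \in S) && (p.2 \in S :\ p.1))).
  rewrite -(pair_big_dep (mem S) (fun x y => y \in S :\ x) (fun _ _ => 1)) /=.
  rewrite -sum_nat_const; apply: eq_bigr => x xS.
  by rewrite sum1_card [#|S|](cardsD1 x) xS.
by move=> p; rewrite !inE [p.2 == _]eq_sym (andbC (p.2 \in S)).
Qed.

Lemma card_pairs_fibers S : #|pairs S| = \sum_(k in keys S) #|fiber S k|.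
Proof.
rewrite -sum1_card (partition_big_imset (key S)) /=; apply: eq_bigr => k _.
by rewrite -sum1_card; apply: eq_bigl => p; rewrite !inE.
Qed.

(** * Two pairs in one class *)

(** The point [c] lies on the line of [ab], but it is not adjacent to [a], so it can only be [b]. *)
Lemma nonedge_uniq S a b c : b \in S -> c \in S -> a != b -> a != c ->
  ~~ e a b -> ~~ e a c -> same_line S a b a c -> b = c.
Proof.
move=> bS cS ab ac /negPf eab /negPf eac /(_ c cS); rewrite /on_line eab eac eqxx.
by rewrite orbT eq_sym (negPf ac) /= orbF => /eqP ->.
Qed.

(** Otherwise [c], being on the line of [ab] and adjacent to [a], is not adjacent to [b]. Equality
    of the lines then makes [b] and [c] twins. *)
Lemma edge_uniq S a b c : twin_free S -> b \in S -> c \in S -> a != b -> a != c ->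
  e a b -> e a c -> same_line S a b a c -> b = c.
Proof.
move=> tf bS cS ab ac eab eac h; apply/eqP; apply: contraT => bc.
have nbc : ~~ e b c.
  have := h c cS; rewrite /on_line eab eac eqxx orbT eq_sym (negPf ac) /=.
  by rewrite eq_sym (negPf bc) /=.
have [v [vS vb vc]] := tf b c bS cS bc nbc.
have := h v vS; rewrite /on_line eab eac (negPf vb) (negPf vc) /=.
rewrite (e_sym b) (e_sym c); have [->|_] := eqVneq v a; first by rewrite eab eac.
by move=> /= /addbI ->; rewrite eqxx.
Qed.

(** If the pairs were disjoint, [a] and [b] would both be adjacent to [c], which would put [c] off
    the line of the edge [ab]. *)
Lemma edge_meets_nonedge S a b c d : [/\ a \in S, b \in S, c \in S & d \in S] ->
  e a b -> ~~ e c d -> same_line S a b c d ->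
  [|| a == c, a == d, b == c | b == d].
Proof.
move=> [aS bS cS dS] eab /negPf ecd h.
have := h a aS; have := h b bS; have := h c cS.
rewrite /on_line eab ecd !eqxx !orbT /= (e_sym c a) (e_sym d a) (e_sym c b) (e_sym d b).
rewrite ![c == _]eq_sym.
have [] := eqVneq a c; have [] := eqVneq a d; have [] := eqVneq b c => //=.
have [] := eqVneq b d => //=.
by case: (e a c); case: (e b c); case: (e a d); case: (e b d).
Qed.

Lemma fiberP S k a b :
  reflect [/\ a \in S, b \in S, a != b & key S (a, b) = k] ((a, b) \in fiber S k).
Proof.
rewrite !inE /=; apply: (iffP idP) => [/andP[/and3P[? ? ?] /eqP]//|[-> -> ->]].
by move=> ->; rewrite eqxx.
Qed.

Lemma fiber_same_line S k a b c d :
  (a, b) \in fiber S k -> (c, d) \in fiber S k -> same_line S a b c d.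
Proof.
by move=> /fiberP[_ _ _ <-] /fiberP[_ _ _ /esym /key_same_line].
Qed.

Lemma card_universal_fiber S p : p \in pairs S -> line_in S p.1 p.2 = S ->
  #|fiber S (key S p)| <= 2.
Proof.
case: p => a b; rewrite inE /= => /and3P[aS bS ab] uab.
apply: (@leq_trans #|[set (a, b); (b, a)]|); last by rewrite cards2; case: (_ != _).
apply/subset_leq_card/subsetP=> -[c d] /fiberP[cS dS cd].
rewrite /key /= uab => -[->]; rewrite eqxx => /setP h.
have := h c; have := h d; rewrite !inE !eqxx !orbT !xpair_eqE.
move=> /esym/orP[]/eqP ed /esym/orP[]/eqP ec; rewrite ?ec ?ed ?eqxx ?orbT //.
  by rewrite ec ed eqxx in cd.
by rewrite ec ed eqxx in cd.
Qed.

(** Two edges, or two nonedges, of the class with the same first point coincide. So the first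
    projection embeds the class into its line, a proper subset of [S]. *)
Lemma card_pure_fiber S p (adj : bool) : twin_free S -> p \in pairs S ->
  {in fiber S (key S p), forall q, e q.1 q.2 = adj} -> line_in S p.1 p.2 != S ->
  #|fiber S (key S p)| < #|S|.
Proof.
move=> tf pS pure nuniv.
have lS : line_in S p.1 p.2 \proper S.
  by rewrite properEneq nuniv; apply/subsetP=> z; rewrite inE => /andP[].
apply: leq_ltn_trans (proper_card lS).
rewrite -(card_in_imset (f := fst)) /=.
  apply/subset_leq_card/subsetP=> _ /imsetP[[c d] /fiberP[cS dS cd] + ->] /=.
  by move=> [<- _]; rewrite inE cS /on_line eqxx.
move=> [a b] [a' c] Db Dc /= eqa; rewrite -{}eqa {a'} in Dc *; congr (_, _).
have h := fiber_same_line Db Dc.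
have := pure _ Db; have := pure _ Dc => /=.
case/fiberP: Db => aS bS ab _; case/fiberP: Dc => _ cS ac _.
case: adj {pure} => ec eb; first exact: (edge_uniq tf bS cS ab ac eb ec h).
by apply: (nonedge_uniq bS cS ab ac _ _ h); rewrite ?ec ?eb.
Qed.

(** * Classes containing both an edge and a nonedge *)

Definition mixed S k a b c :=
  [/\ (a, b) \in fiber S k, (a, c) \in fiber S k, e a b & ~~ e a c].

Lemma large_fiber_mixed S p : twin_free S -> 3 <= #|S| -> p \in pairs S ->
  #|S| <= #|fiber S (key S p)| -> exists a b c, mixed S (key S p) a b c.
Proof.
move=> tf S3 pS big.
have nuniv : line_in S p.1 p.2 != S.
  apply: contraTneq big => /(card_universal_fiber pS) le2.
  by rewrite -ltnNge (leq_ltn_trans le2).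
have notpure adj : exists2 q, q \in fiber S (key S p) & e q.1 q.2 != adj.
  apply/exists_inP; apply: contraTT big; rewrite negb_exists_in => /forall_inP h.
  rewrite -ltnNge; apply: (card_pure_fiber (adj := adj)) => // q /h.
  by rewrite negbK => /eqP.
have [[a b] Dab /=] := notpure false; rewrite eqbF_neg negbK => eab.
have [[c d] Dcd /=] := notpure true; rewrite eqb_id => ncd.
have h := fiber_same_line Dab Dcd.
case/fiberP: (Dab) => aS bS ab _; case/fiberP: (Dcd) => cS dS cd _.
have Dba := fiber_swap Dab; have Ddc := fiber_swap Dcd.
(* Whichever point the two pairs share takes the role of [a] in [mixed]. *)
have := edge_meets_nonedge (And4 aS bS cS dS) eab ncd h.
case/or4P=> /eqP eq.
- by exists a, b, d; split; rewrite // eq.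
- by exists a, b, c; split; rewrite // eq // e_sym.
- by exists b, a, d; split; rewrite // ?eq // -?eq // e_sym.
- by exists b, a, c; split; rewrite // ?eq // -?eq // e_sym // eq.
Qed.

Lemma mixed_neq S k a b c : mixed S k a b c -> [/\ a != b, a != c & b != c].
Proof.
case=> /fiberP[_ _ ab _] /fiberP[_ _ ac _] eab eac; split=> //.
by apply: contraTneq eab => ->.
Qed.

(** The point [b] lies on the line of the nonedge [ac]. *)
Lemma mixed_adj S k a b c : mixed S k a b c -> e b c.
Proof.
move=> m; have [ab ac bc] := mixed_neq m; case: m => Db Dc eab /negPf eac.
case/fiberP: (Db) => _ bS _ _; have := fiber_same_line Db Dc bS.
rewrite /on_line eac eqxx orbT [b == a]eq_sym (negPf ab) (negPf bc) /=.
by rewrite eab e_sym.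
Qed.

(** The edge [uv] meets the nonedge [ac]; if it does so at [a], it is [ab] by [edge_uniq]. *)
Lemma mixed_edge S k a b c u v : twin_free S -> mixed S k a b c ->
  (u, v) \in fiber S k -> e u v ->
  [|| (u, v) == (a, b), (u, v) == (b, a), u == c | v == c].
Proof.
move=> tf [Db Dc eab eac] Duv euv.
have Dvu := fiber_swap Duv.
case/fiberP: (Db) => aS bS ab _; case/fiberP: (Dc) => _ cS ac _.
case/fiberP: (Duv) => uS vS uv _.
have := edge_meets_nonedge (And4 uS vS aS cS) euv eac (fiber_same_line Duv Dc).
case/or4P=> [/eqP eq|->|/eqP eq|->]; rewrite ?orbT //.
- move: Duv uv euv; rewrite eq => Duv uv euv.
  by rewrite (edge_uniq tf vS bS uv ab euv eab (fiber_same_line Duv Db)) eqxx.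
- move: Dvu uv euv; rewrite eq e_sym eq_sym => Dvu uv euv.
  by rewrite (edge_uniq tf uS bS uv ab euv eab (fiber_same_line Dvu Db)) eqxx orbT.
Qed.

(** The nonedge [uv] meets the edge [ab]; if it does so at [a], it is [ac] by [nonedge_uniq]. *)
Lemma mixed_nonedge S k a b c u v : mixed S k a b c ->
  (u, v) \in fiber S k -> ~~ e u v ->
  [|| (u, v) == (a, c), (u, v) == (c, a), u == b | v == b].
Proof.
move=> [Db Dc eab eac] Duv euv.
have Dvu := fiber_swap Duv.
case/fiberP: (Db) => aS bS ab _; case/fiberP: (Dc) => _ cS ac _.
case/fiberP: (Duv) => uS vS uv _.
have := edge_meets_nonedge (And4 aS bS uS vS) eab euv (fiber_same_line Db Duv).
rewrite ![b == _]eq_sym.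
case/or4P=> [/eqP eq|/eqP eq|->|->]; rewrite ?orbT //.
- move: Duv uv euv; rewrite -eq => Duv uv euv.
  by rewrite (nonedge_uniq vS cS uv ac euv eac (fiber_same_line Duv Dc)) eqxx.
- move: Dvu uv euv; rewrite -eq e_sym eq_sym => Dvu uv euv.
  by rewrite (nonedge_uniq uS cS uv ac euv eac (fiber_same_line Dvu Dc)) eqxx orbT.
Qed.

(* An induced 4-cycle a, b, c, d whose side ab and diagonal ac lie in one class,
   with a third pair. *)
Definition square S k a b c d :=
  [/\ mixed S k a b c, [/\ d \in S, d != a, d != b & d != c],
      [/\ e b c, e c d, e a d & ~~ e b d]
    & ((c, d) \in fiber S k) || ((b, d) \in fiber S k)].

(** The third pair is an edge [cd] or a nonedge [bd]. Evaluating the equal lines at two of the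
    points [a], [b], [c] yields the missing adjacencies. *)
Lemma mixed_square S k a b c u v : twin_free S -> mixed S k a b c ->
  (u, v) \in fiber S k ->
  (u, v) \notin [:: (a, b); (b, a); (a, c); (c, a)] ->
  exists d, square S k a b c d.
Proof.
move=> tf m Duv; rewrite !inE !negb_or => /and4P[uvab uvba uvac uvca].
have [ab ac bc] := mixed_neq m; have ebc := mixed_adj m.
have [Dab Dac eab eac] := m.
case/fiberP: (Dab) => aS bS _ _; case/fiberP: (Dac) => _ cS _ _.
have [euv|euv] := boolP (e u v).
  have [d [Dcd ecd]] : exists d, (c, d) \in fiber S k /\ e c d.
    have := mixed_edge tf m Duv euv; rewrite (negPf uvab) (negPf uvba) /=.
    case/orP=> /eqP eq; rewrite -eq; first by exists v.
    by exists u; rewrite e_sym (fiber_swap Duv).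
  case/fiberP: (Dcd) => _ dS cd _; exists d.
  have da : d != a by apply: contraTneq ecd => ->; rewrite e_sym.
  have h := fiber_same_line Dab Dcd.
  (* If [d] were [b], the edges [ba] and [bc] would share a class. *)
  have db : d != b.
    apply: contraNneq ac => eqd; rewrite {}eqd in Dcd *; apply/eqP.
    apply: (edge_uniq (a := b) tf) => //; rewrite 1?eq_sym // 1?e_sym //.
    exact: fiber_same_line (fiber_swap Dab) (fiber_swap Dcd).
  have := h a aS; have := h b bS; rewrite /on_line eab ecd !eqxx !orbT /=.
  rewrite (negPf ac) (negPf bc) ![_ == d]eq_sym (negPf da) (negPf db) /=.
  rewrite [e c b]e_sym ebc [e c a]e_sym (negPf eac) [e d b]e_sym [e d a]e_sym /=.
  move=> /esym ebd /esym ead; split=> //; last by rewrite Dcd.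
  by split=> //; rewrite eq_sym.
have [d [Dbd ebd]] : exists d, (b, d) \in fiber S k /\ ~~ e b d.
  have := mixed_nonedge m Duv euv; rewrite (negPf uvac) (negPf uvca) /=.
  case/orP=> /eqP eq; rewrite -eq; first by exists v.
  by exists u; rewrite e_sym (fiber_swap Duv).
case/fiberP: (Dbd) => _ dS bd _; exists d.
have da : d != a by apply: contraNneq ebd => ->; rewrite e_sym.
have dc : d != c by apply: contraNneq ebd => ->.
have h := fiber_same_line Dac Dbd.
have := h a aS; have := h c cS.
rewrite /on_line (negPf eac) (negPf ebd) !eqxx !orbT /=.
rewrite ![_ == d]eq_sym (negPf ab) [c == b]eq_sym (negPf bc) (negPf da) (negPf dc) /=.
rewrite ebc [e b a]e_sym eab [e d c]e_sym [e d a]e_sym /=.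
move=> /esym ecd /esym ead; split=> //; last by rewrite Dbd orbT.
by split=> //; rewrite eq_sym.
Qed.

(** By [mixed_edge] and [mixed_nonedge], a further edge contains [c] and a further nonedge contains
    [b]. The other end is [d] in both cases. *)
Lemma square_fiber S k a b c d : twin_free S -> square S k a b c d ->
  fiber S k \subset
    [:: (a, b); (b, a); (a, c); (c, a); (c, d); (d, c); (b, d); (d, b)].
Proof.
move=> tf [m [dS da db dc] [ebc ecd ead ebd] Dd]; apply/subsetP=> -[u v] Duv.
have [ab ac bc] := mixed_neq m; have [Dab Dac eab eac] := m.
case/fiberP: (Dab) => aS bS _ _; case/fiberP: (Dac) => _ cS _ _.
have edge w : (c, w) \in fiber S k -> e c w -> w = d.
  move=> Dcw ecw; case/fiberP: (Dcw) => _ wS cw _.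
  case/orP: Dd => Dd.
    by apply: (edge_uniq tf wS dS cw _ ecw ecd (fiber_same_line Dcw Dd)); rewrite eq_sym.
  have := edge_meets_nonedge (And4 cS wS bS dS) ecw ebd (fiber_same_line Dcw Dd).
  rewrite ![c == _]eq_sym (negPf bc) (negPf dc) /= => /orP[/eqP eqw|/eqP //].
  rewrite {}eqw in Dcw ecw; case/eqP: ac.
  apply: (edge_uniq (a := b) tf) => //; rewrite 1?eq_sym // 1?e_sym //.
  exact: fiber_same_line (fiber_swap Dab) (fiber_swap Dcw).
have nonedge w : (b, w) \in fiber S k -> ~~ e b w -> w = d.
  move=> Dbw ebw; case/fiberP: (Dbw) => _ wS bw _.
  case/orP: Dd => Dd.
    have := edge_meets_nonedge (And4 cS dS bS wS) ecd ebw (fiber_same_line Dd Dbw).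
    rewrite [c == b]eq_sym (negPf bc) (negPf db) /= => /orP[/eqP eqw|/eqP //].
    by rewrite -eqw ebc in ebw.
  by apply: (nonedge_uniq wS dS bw _ ebw ebd (fiber_same_line Dbw Dd)); rewrite eq_sym.
have Dvu := fiber_swap Duv; rewrite !inE.
have [euv|euv] := boolP (e u v).
  case/or4P: (mixed_edge tf m Duv euv) => [->|->|/eqP eq|/eqP eq]; rewrite ?orbT //.
    by rewrite eq in Duv euv *; rewrite (edge v Duv euv) eqxx !orbT.
  by rewrite eq e_sym in Dvu euv *; rewrite (edge u Dvu euv) eqxx !orbT.
case/or4P: (mixed_nonedge m Duv euv) => [->|->|/eqP eq|/eqP eq]; rewrite ?orbT //.
  by rewrite eq in Duv euv *; rewrite (nonedge v Duv euv) eqxx !orbT.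
by rewrite eq e_sym in Dvu euv *; rewrite (nonedge u Dvu euv) eqxx !orbT.
Qed.

Lemma card_square_fiber S k a b c d : twin_free S -> square S k a b c d ->
  #|fiber S k| <= 8.
Proof.
move=> tf /(square_fiber tf)/subset_leq_card le; apply: leq_trans le _.
exact: card_size.
Qed.

(** Without [cd] or without [bd], three unordered pairs are left, hence at most 6 ordered ones. *)
Lemma square_fiber_full S k a b c d : twin_free S -> square S k a b c d ->
  6 < #|fiber S k| -> (c, d) \in fiber S k /\ (b, d) \in fiber S k.
Proof.
move=> tf sq big; have sub := square_fiber tf sq.
have notin x y p : (x, y) \notin fiber S k -> p \in fiber S k ->
    (p == (x, y) = false) * (p == (y, x) = false).
  move=> nD Dp; split; apply: contraNF nD => /eqP eqp; rewrite eqp in Dp => //.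
  exact: fiber_swap.
split; apply: contraLR big => nD; rewrite -leqNgt.
  apply: (@leq_trans #|[:: (a, b); (b, a); (a, c); (c, a); (b, d); (d, b)]|).
    apply/subset_leq_card/subsetP=> p Dp; have := subsetP sub p Dp.
    by rewrite !inE !(notin _ _ _ nD Dp).
  exact: card_size.
apply: (@leq_trans #|[:: (a, b); (b, a); (a, c); (c, a); (c, d); (d, c)]|).
  apply/subset_leq_card/subsetP=> p Dp; have := subsetP sub p Dp.
  by rewrite !inE !(notin _ _ _ nD Dp) ?orbF.
exact: card_size.
Qed.

(* The opposite sides of a square come in two classes; the second one has no
   room for a nonedge, since both diagonals already lie in the first. *)
Lemma square_companion S k l a b c d u v : twin_free S -> square S k a b c d ->
  (c, d) \in fiber S k -> (b, d) \in fiber S k ->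
  (a, d) \in fiber S l -> (u, v) \in fiber S l -> e u v.
Proof.
move=> tf [[Dab Dac eab eac] [dS da db dc] [ebc ecd ead ebd] _] Dcd Dbd Dad Duv.
apply: contraT => euv.
case/fiberP: (Dab) => aS bS ab _; case/fiberP: (Dac) => _ cS ac _.
case/fiberP: (Duv) => uS vS uv _; have Dvu := fiber_swap Duv.
have had := fiber_same_line Dad Duv.
have bc : b != c by apply: contraTneq eab => ->.
(* Off the square, equality of the lines of [ab] and [cd] is an equation between sums modulo 2;
   regrouped, it says that the lines of [ad] and [bc] agree. *)
have hbc : same_line S b c u v.
  move=> z zS; rewrite -(had z zS); have := fiber_same_line Dab Dcd zS.
  rewrite /on_line eab ecd ead ebc.
  have [->|_] := eqVneq z a.
    by rewrite /= [e b a]e_sym [e c a]e_sym eab (negPf eac) ?orbT.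
  have [->|_] := eqVneq z b.
    by rewrite /= [e d b]e_sym eab (negPf ebd) ?orbT.
  have [->|_] := eqVneq z c.
    by rewrite /= [e d c]e_sym ecd (negPf eac) ?orbT.
  have [->|_] := eqVneq z d.
    by rewrite /= ecd (negPf ebd) ?orbT.
  by case: (e a z); case: (e b z); case: (e c z); case: (e d z).
(* The nonedges between {[a], [d]} and {[b], [c]} are the diagonals. They lie in class [k], which
   differs from [l]: otherwise the edges [ab] and [ad] would share a class. *)
have no x y : (x, y) \in fiber S l -> ~~ e x y ->
    (x == a) || (x == d) -> (y == b) || (y == c) -> False.
  have nol (z w : T) : (z, w) \in fiber S k -> (z, w) \in fiber S l -> False.
    move=> Dk Dl; case/eqP: db; apply/esym.
    apply: (edge_uniq tf bS dS ab _ eab ead); first by rewrite eq_sym.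
    exact: same_line_trans (fiber_same_line Dab Dk) (fiber_same_line Dl Dad).
  move=> Dxy exy /orP[]/eqP eqx /orP[]/eqP eqy; rewrite {}eqx {}eqy in Dxy exy.
  - by rewrite eab in exy.
  - exact: nol Dac Dxy.
  - exact: nol (fiber_swap Dbd) Dxy.
  - by rewrite e_sym ecd in exy.
have ad_bc x : (x == a) || (x == d) -> (x == b) || (x == c) = false.
  by case/orP=> /eqP->; rewrite ?(negPf ab) ?(negPf ac) ?(negPf db) ?(negPf dc).
(* The nonedge [uv] meets both [ad] and [bc], so it has one end in each. *)
have ad_uv : ((u == a) || (u == d)) || ((v == a) || (v == d)).
  rewrite orbACA -orbA ![u == _]eq_sym ![v == _]eq_sym.
  exact: edge_meets_nonedge (And4 aS dS uS vS) ead euv had.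
have bc_uv : ((u == b) || (u == c)) || ((v == b) || (v == c)).
  rewrite orbACA -orbA ![u == _]eq_sym ![v == _]eq_sym.
  exact: edge_meets_nonedge (And4 bS cS uS vS) ebc euv hbc.
case/orP: ad_uv => [ad_u|ad_v].
  rewrite (ad_bc u ad_u) in bc_uv; case: (no _ _ Duv euv ad_u bc_uv).
rewrite (ad_bc v ad_v) orbF in bc_uv; case: (no _ _ Dvu _ ad_v bc_uv).
by rewrite e_sym.
Qed.

(** * Deleting one of two nonadjacent twins *)

Section DeleteTwin.

Context (S : {set T}) (y z : T).
Context (yS : y \in S) (zS : z \in S) (yz : y != z) (eyz : ~~ e y z).
Context (twins : {in S, forall v, v != y -> v != z -> e v y = e v z}).

Lemma twin_on_line a b : (a, b) \in pairs (S :\ z) ->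
  on_line a b z -> on_line a b y.
Proof.
rewrite !inE /= => /and3P[/andP[az aS] /andP[bz bS] _].
rewrite /on_line ![z == _]eq_sym (negPf az) (negPf bz) /= ![y == _]eq_sym.
have [//|ay] := eqVneq a y; have [|by_] := eqVneq b y => //=.
by rewrite !twins.
Qed.

(** If [y] is not a generator, [z] has the same adjacencies to the generators. If [y] is a generator
    joined to the other one, so is [z], and [z] is on the line because it is not adjacent to [y]. *)
Lemma off_line_twin a b : (a, b) \in pairs (S :\ z) ->
  on_line a b y -> ~~ on_line a b z -> ((a == y) || (b == y)) && ~~ e a b.
Proof.
rewrite !inE /= => /and3P[/andP[az aS] /andP[bz bS] ab].
rewrite /on_line ![z == _]eq_sym (negPf az) (negPf bz) /= ![y == _]eq_sym.
have [eqa|ay] := eqVneq a y; have [eqb|by_] := eqVneq b y => //=.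
- by rewrite eqa eqb eqxx in ab.
- by rewrite eqa -(twins bS by_ bz) (negPf eyz) [e y b]e_sym; case: (e b y).
- by rewrite eqb -(twins aS ay az) (negPf eyz); case: (e a y).
by rewrite !twins // => ->.
Qed.

(** The delicate case is a line equal to [S] without [z]: it becomes universal by the deletion, so
    its class must not split. By [off_line_twin] it is generated only by nonedges at [y], and these
    coincide by [nonedge_uniq]. *)
Lemma key_del_twin p q : p \in pairs (S :\ z) -> q \in pairs (S :\ z) ->
  key S p = key S q -> key (S :\ z) p = key (S :\ z) q.
Proof.
case: p q => [a b] [c d] pS qS eqk; have [eqL eqU] := eqk.
have delL u v : line_in (S :\ z) u v = line_in S u v :\ z.
  by apply/setP=> x; rewrite !inE andbA.
rewrite /key /= !delL /= eqL; congr (_, _); case: eqP => // univ.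
move: eqU; rewrite /= eqL; case: eqP => // nuniv _.
have onS x : x \in S :\ z -> on_line c d x by rewrite -univ !inE => /and3P[].
have offz : ~~ on_line c d z.
  apply/negP=> onz; apply: nuniv; apply/setP=> x; rewrite inE.
  have [->|xz] := eqVneq x z; rewrite ?onz ?andbT //.
  by case: (boolP (x \in S)) => //= xS;
    apply: onS; rewrite !inE xz.
have ony : on_line c d y by apply: onS; rewrite !inE yz.
have h := key_same_line eqk; rewrite /= in h.
have := off_line_twin qS ony offz; have := off_line_twin pS.
rewrite !h // => /(_ ony offz).
move: pS qS; rewrite !inE /= => /and3P[/andP[_ aS] /andP[_ bS] ab].
move=> /and3P[/andP[_ cS] /andP[_ dS] cd].
move=> /andP[/orP[]/eqP eq1 e1] /andP[/orP[]/eqP eq2 e2]; subst.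
- by rewrite (nonedge_uniq bS dS ab cd e1 e2 h).
- rewrite (nonedge_uniq bS cS ab _ e1 _ (same_lineCr h)) 1?eq_sym // 1?e_sym //.
  by rewrite setUC.
- rewrite (nonedge_uniq aS dS _ cd _ e2 (same_lineCl h)) 1?eq_sym // 1?e_sym //.
  by rewrite setUC.
rewrite (nonedge_uniq aS cS _ _ _ _ (same_lineCl (same_lineCr h))) //.
all: by rewrite 1?eq_sym // e_sym.
Qed.

Lemma card_keys_del_twin : #|keys (S :\ z)| < #|keys S|.
Proof.
have subP : pairs (S :\ z) \subset pairs S.
  by apply/subsetP=> p; rewrite !inE => /and3P[/andP[_ ->] /andP[_ ->] ->].
apply: (@leq_ltn_trans #|key S @: pairs (S :\ z)|).
  exact: leq_card_imset_factor key_del_twin.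
apply: proper_card; rewrite properE imsetS //=; apply/subsetPn.
have new x : x \in S -> x != z ->
    (forall a b, (a, b) \in pairs (S :\ z) -> key S (z, x) <> key S (a, b)) ->
    exists2 k, k \in keys S & k \notin key S @: pairs (S :\ z).
  move=> xS xz neq; exists (key S (z, x)).
    by apply: imset_f; rewrite inE zS xS eq_sym.
  by apply/imsetP=> -[[a b] /neq].
have [/existsP[x /and4P[xS xy xz exy]]|] :=
  boolP [exists x, [&& x \in S, x != y, x != z & ~~ e x y]].
  (* The line of [zx] contains [z] but not [y], against [twin_on_line]. *)
  apply: (new x) => // a b abS /key_same_line h.
  have := twin_on_line abS; rewrite -!h //= => /(_ _)/wrap[].
    by rewrite /on_line eqxx.
  rewrite /on_line (negPf yz) eq_sym (negPf xy) e_sym -twins // (negPf exy) /=.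
  by rewrite e_sym (negPf eyz).
rewrite negb_exists => /forallP all_adj; apply: (new y) => // a b abS [_].
(* Now every other point is adjacent to both twins, so [zy] is universal and its key records [z]. *)
have univ : line_in S z y = S.
  apply/setP=> x; rewrite inE; case: (boolP (x \in S)) => //= xS.
  rewrite /on_line [e z y]e_sym (negPf eyz).
  have [//|xz] := eqVneq x z; have [//|xy] := eqVneq x y.
  have := all_adj x; rewrite xS xy xz /= negbK => exy.
  by rewrite [e z x]e_sym [e y x]e_sym -twins // exy.
rewrite /= univ eqxx => /setP/(_ z); rewrite !inE eqxx /=.
move: abS; rewrite !inE /= ![_ == z]eq_sym => /and3P[/andP[az _] /andP[bz _] _].
by case: ifP => _; rewrite !inE // (negPf az) (negPf bz).
Qed.

End DeleteTwin.

(** * Transfer to encoded graphs *)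

Definition graph_of x0 (s : seq T) :=
  [seq [seq e (nth x0 s i) (nth x0 s j) | j <- iota 0 i] | i <- iota 0 (size s)].

Lemma size_graph_of x0 s : size (graph_of x0 s) = size s.
Proof. by rewrite size_map size_iota. Qed.

Lemma nth_graph_of x0 s i : i < size s ->
  nth [::] (graph_of x0 s) i = [seq e (nth x0 s i) (nth x0 s j) | j <- iota 0 i].
Proof. by move=> lt_i; rewrite (nth_map 0) ?size_iota // nth_iota. Qed.

Lemma adj_graph_of x0 s i j : i < size s -> j < size s -> i != j ->
  adj (graph_of x0 s) i j = e (nth x0 s i) (nth x0 s j).
Proof.
rewrite /adj => lt_i lt_j ij; case: ltngtP ij => // lt_ij _;
  rewrite nth_graph_of // (nth_map 0) ?size_iota // nth_iota ?add0n //.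
Qed.

(** The key of a pair of points determines the [mask_key] of its indices, so there are at least as
    many keys. *)
Lemma card_keys_enough_lines S x0 s : uniq s -> s =i S ->
  enough_lines (graph_of x0 s) -> #|S| <= #|keys S|.
Proof.
move=> us sS; have -> : #|S| = size s by rewrite -(eq_card sS); exact/card_uniqP.
rewrite /enough_lines size_graph_of => /leq_trans; apply.
pose K (p : nat * nat) := key S (nth x0 s p.1, nth x0 s p.2).
have pairP (p : nat * nat) : p \in index_pairs (size s) ->
    [/\ p.1 < size s, p.2 < size s & p.1 < p.2].
  case/allpairsPdep=> j [i [+ + ->]] /=.
  by rewrite !mem_iota /= !add0n => lt_j lt_i; split; rewrite // (ltn_trans lt_i).
have inS i : i < size s -> nth x0 s i \in S by move=> ?; rewrite -sS mem_nth.
apply: (@leq_trans (size (undup (map K (index_pairs (size s)))))); last first.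
  rewrite cardE; apply: uniq_leq_size (undup_uniq _) _ => k.
  rewrite mem_undup mem_enum => /mapP[p /pairP[p1 p2 p12] ->].
  by apply: imset_f; rewrite inE /= !inS // nth_uniq // neq_ltn p12.
have maskE (p : nat * nat) : p \in index_pairs (size s) ->
    mask (graph_of x0 s) p.1 p.2 =
    [seq nth x0 s k \in line_in S (nth x0 s p.1) (nth x0 s p.2) | k <- iota 0 (size s)].
  case/pairP=> p1 p2 p12; rewrite /mask size_graph_of.
  apply/eq_in_map => k; rewrite mem_iota add0n /= => lt_k.
  rewrite inE inS //= /on_line !nth_uniq // adj_graph_of // ?neq_ltn ?p12 //.
  by have [|kp1] := eqVneq k p.1 => //; have [|kp2] := eqVneq k p.2 => //=;
     rewrite !adj_graph_of // eq_sym.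
apply: size_undup_map_factor => p q pP qP eqK.
have [eqL eqU] := eqK; rewrite /= in eqL eqU.
have eqm : mask (graph_of x0 s) p.1 p.2 = mask (graph_of x0 s) q.1 q.2.
  by rewrite !maskE // eqL.
rewrite /mask_key eqm; congr (_, _); case: ifP => // univ; congr Some.
have lineS : line_in S (nth x0 s q.1) (nth x0 s q.2) = S.
  apply/setP=> x; apply/idP/idP=> [|xS]; first by rewrite inE => /andP[].
  move: univ; rewrite maskE // all_map => /allP/(_ (index x s)).
  by rewrite mem_iota add0n /= index_mem nth_index sS //; apply.
move: eqU; rewrite eqL lineS eqxx => /setP eqU.
have [p1 p2 p12] := pairP p pP; have [q1 q2 q12] := pairP q qP.
have := eqU (nth x0 s p.1); have := eqU (nth x0 s p.2).
rewrite !inE !eqxx !orbT !nth_uniq //.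
(* Both index pairs are increasing, so equal 2-sets can only be matched in order. *)
move=> /esym/orP[]/eqP e2 /esym/orP[]/eqP e1; move: p12 q12.
- by rewrite e1 e2 ltnn.
- by rewrite e1 e2 => lt1 /(ltn_trans lt1); rewrite ltnn.
- by case: p q e1 e2 {pP qP eqK eqm univ eqL lineS eqU p1 p2 q1 q2} => ? ? [? ?] /= -> ->.
- by rewrite e1 e2 ltnn.
Qed.

Lemma card_keys_small S : 3 <= #|S| <= 4 -> #|S| <= #|keys S|.
Proof.
move=> S34; have [x0 _] : exists x, x \in S.
  by apply/card_gt0P; case/andP: S34 => /ltnW/ltnW.
apply: (@card_keys_enough_lines S x0 (enum S)); rewrite ?enum_uniq //.
  by move=> x; rewrite mem_enum.
apply: (allP (enough_lines_small S34)); apply: mem_graphs.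
  by rewrite size_graph_of size_map size_iota cardE.
move=> i; rewrite size_map size_iota => lt_i.
rewrite nth_graph_of -?cardE // (nth_map 0) ?size_iota // nth_iota //.
by set r := map _ _; have := mem_bitseqs r; rewrite size_map size_iota.
Qed.

Definition square_enum S a b c d := [:: a; b; c; d] ++ enum (S :\: [set a; b; c; d]).

Lemma square_enumP S k a b c d : square S k a b c d ->
  uniq (square_enum S a b c d) /\ square_enum S a b c d =i S.
Proof.
move=> [m [dS da db dc] _ _]; have [ab ac bc] := mixed_neq m.
case: m => /fiberP[aS bS _ _] /fiberP[_ cS _ _] _ _.
split.
  rewrite cat_uniq enum_uniq andbT; apply/andP; split.
    by rewrite /= !inE !negb_or ab ac bc ![_ == d]eq_sym da db dc.
  apply/hasPn=> x; rewrite mem_enum !inE -!orbA => /andP[]; exact.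
move=> x; rewrite mem_cat mem_enum !inE -!orbA.
by case: eqVneq => [->|_]; last case: eqVneq => [->|_]; last case: eqVneq => [->|_];
  last case: eqVneq => [->|_].
Qed.

(** Listing [a], [b], [c], [d] first makes the square fix the first four rows, so only the rows of
    the other points need be checked. *)
Lemma square_graph S k a b c d rows : square S k a b c d ->
  #|S| = 4 + size rows ->
  (forall i, i < size rows ->
     nth [::] (graph_of a (square_enum S a b c d)) (4 + i) \in nth [::] rows i) ->
  all enough_lines (graphs (square_rows ++ rows)) -> #|S| <= #|keys S|.
Proof.
move=> sq cardS hrows /allP enough.
have [us sS] := square_enumP sq.
have size_s : size (square_enum S a b c d) = #|S|.
  by rewrite -(eq_card sS); exact/esym/card_uniqP.
apply: (card_keys_enough_lines us sS (x0 := a)); apply: enough; apply: mem_graphs.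
  by rewrite size_graph_of size_s size_cat.
case: sq => [[_ _ eab /negPf eac] _ [ebc ecd ead /negPf ebd] _].
move=> i; rewrite size_cat /= => lt_i.
have [i4|i4] := leqP 4 i.
  by rewrite -(subnKC i4); apply: (hrows (i - 4)); rewrite ltn_subLR.
rewrite nth_graph_of ?size_s ?cardS //.
move: i i4 {lt_i} => [|[|[|[|]]]] //= _; rewrite inE.
- by rewrite e_sym eab.
- by rewrite [e c a]e_sym [e c b]e_sym eac ebc.
- by rewrite [e d a]e_sym [e d b]e_sym [e d c]e_sym ead ebd ecd.
Qed.

(** Membership of [v] in the four equal lines equates two sums modulo 2 with two conjunctions. The
    common value cannot be true, since all four adjacencies would then hold and make the sums
    false. *)
Lemma outside_full_square S k a b c d v : square S k a b c d ->
  (c, d) \in fiber S k -> (b, d) \in fiber S k ->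
  v \in S -> v \notin [set a; b; c; d] ->
  [:: e v a; e v b; e v c; e v d] \in outside_square.
Proof.
move=> [[Dab Dac eab /negPf eac] _ [_ ecd _ /negPf ebd] _] Dcd Dbd vS.
rewrite !inE !negb_or -!andbA => /and4P[va vb vc vd].
have := fiber_same_line Dab Dac vS; have := fiber_same_line Dab Dcd vS.
have := fiber_same_line Dab Dbd vS.
rewrite /on_line eab eac ecd ebd (negPf va) (negPf vb) (negPf vc) (negPf vd) /=.
rewrite ![e _ v]e_sym.
by case: (e v a); case: (e v b); case: (e v c); case: (e v d).
Qed.

(** * Counting ordered pairs and conclusion for graphs *)

(** If every class had at most n - 1 of the n(n - 1) ordered pairs, there would be at least n
    classes. *)
Lemma exists_large_fiber S : 2 <= #|S| -> #|keys S| < #|S| ->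
  exists2 p, p \in pairs S & #|S| <= #|fiber S (key S p)|.
Proof.
move=> S2 few; apply/exists_inP; apply: contraTT few.
rewrite negb_exists_in => /forall_inP small; rewrite -leqNgt.
rewrite -(@leq_pmul2r #|S|.-1); last by case: #|S| S2.
rewrite -card_pairs card_pairs_fibers -sum_nat_const; apply: leq_sum => k.
by case/imsetP=> p /small + ->; rewrite -ltnNge; case: #|S| S2.
Qed.

Lemma large_fiber_square S p : twin_free S -> 5 <= #|S| -> p \in pairs S ->
  #|S| <= #|fiber S (key S p)| -> exists a b c d, square S (key S p) a b c d.
Proof.
move=> tf S5 pS big.
have [a [b [c m]]] := large_fiber_mixed tf (ltnW (ltnW S5)) pS big.
have /subsetPn[[u v] Duv nuv] :
    ~~ (fiber S (key S p) \subset [:: (a, b); (b, a); (a, c); (c, a)]).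
  apply: contraTN (leq_trans S5 big) => /subset_leq_card le.
  by rewrite -leqNgt (leq_trans le (card_size _)).
by have [d] := mixed_square tf m Duv nuv; exists a, b, c, d.
Qed.

Lemma card_keys_twin_free S : twin_free S -> 3 <= #|S| -> #|S| <= #|keys S|.
Proof.
move=> tf S3; have [le4|S5] := leqP #|S| 4.
  by apply: card_keys_small; rewrite S3.
rewrite leqNgt; apply/negP=> few.
have [p pS big] := exists_large_fiber (ltnW S3) few.
have [a [b [c [d sq]]]] := large_fiber_square tf S5 pS big.
(* The original inequality becomes the goal again, for the enumerations; [few] is kept for the case
   of 8 points. *)
have := few; rewrite ltnNge => /negP; apply.
have S8 := leq_trans big (card_square_fiber tf sq).
have [le6|S7] := leqP #|S| 6.
  have S56 : 5 <= #|S| <= 6 by rewrite S5.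
  apply: (square_graph sq) (enough_lines_square S56).
    by rewrite size_map size_iota subnKC // ltnW.
  have [us sS] := square_enumP sq.
  move=> i; rewrite size_map size_iota => lt_i.
  rewrite nth_graph_of; last first.
    by rewrite -(card_uniqP us) (eq_card sS) -ltn_subRL.
  rewrite (nth_map 0) ?size_iota // nth_iota //.
  by set r := map _ _; have := mem_bitseqs r; rewrite size_map size_iota.
have [Dcd Dbd] := square_fiber_full tf sq (leq_trans S7 big).
have [us sS] := square_enumP sq.
move: S8; rewrite leq_eqVlt => /orP[/eqP S8|lt8].
  have [aS dS ad] : [/\ a \in S, d \in S & a != d].
    by case: sq => [[/fiberP[? _ _ _] _ _ _] [? da _ _] _ _]; rewrite eq_sym.
  have adS : (a, d) \in pairs S by rewrite inE aS dS.
  have bound q : q \in pairs S -> #|fiber S (key S q)| <= 8.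
    move=> qS; have [bigq|/ltnW] := leqP #|S| #|fiber S (key S q)|; last by rewrite S8.
    have [a' [b' [c' [d' sq']]]] := large_fiber_square tf S5 qS bigq.
    exact: card_square_fiber tf sq'.
  (* At most 7 classes of at most 8 ordered pairs share 56 pairs: the classes other than that of
     [ad] take at most 48, leaving at least 8. *)
  have bigad : #|S| <= #|fiber S (key S (a, d))|.
    have := card_pairs S; rewrite card_pairs_fibers S8.
    rewrite (bigD1 (key S (a, d))) ?imset_f //= => sum56.
    have : \sum_(k in keys S | k != key S (a, d)) #|fiber S k| <= #|keys S|.-1 * 8.
      have -> : #|keys S|.-1 = #|keys S :\ key S (a, d)|.
        by rewrite [#|keys S|](cardsD1 (key S (a, d))) imset_f.
      rewrite -sum_nat_const (eq_bigl (mem (keys S :\ key S (a, d)))); last first.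
        by move=> k; rewrite !inE andbC.
      apply: leq_sum => k; rewrite /= in_setD1 => /andP[_ /imsetP[q qS ->]]; exact: bound.
    rewrite S8 in few *; move: few sum56; set N := #|keys S|; set f := #|fiber S _|.
    set r := \sum_(_ in _ | _) _.
    move=> few sum56 rN; have {}rN : r <= 48.
      by apply: leq_trans rN _; rewrite (leq_mul2r 8 _ 6) /= -ltnS; case: N few.
    by rewrite -(leq_add2r r) sum56 (leq_trans (_ : 8 + r <= 8 + 48)) // leq_add2l.
  (* Being large, the class of [ad] contains a nonedge, which [square_companion] excludes. *)
  have [a' [b' [c' m]]] := large_fiber_mixed tf S3 adS bigad.
  have Dad : (a, d) \in fiber S (key S (a, d)) by rewrite inE adS eqxx.
  case: m => _ Dac' _ /negP; case.
  exact: (square_companion tf sq Dcd Dbd Dad Dac').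
have S7' : #|S| = 7 by apply/eqP; rewrite eqn_leq S7 -ltnS lt8.
apply: (square_graph sq) enough_lines_full_square; first by rewrite S7'.
move=> i; rewrite size_map size_iota => lt_i.
have lt4i : 4 + i < size (square_enum S a b c d).
  by rewrite -(card_uniqP us) (eq_card sS) S7' -[7]/(4 + 3) ltn_add2l.
(* The row splits into the four adjacencies to the square and the free remainder. *)
rewrite nth_graph_of // iotaD map_cat.
rewrite (nth_map 0) ?size_iota // nth_iota //; apply: allpairs_f.
  apply: (outside_full_square sq) => //; first by rewrite -sS mem_nth.
  have : nth a (square_enum S a b c d) (4 + i) \in enum (S :\: [set a; b; c; d]).
    rewrite nth_cat ltnNge leq_addr /= addKn; apply: mem_nth.
    by move: lt4i; rewrite size_cat ltn_add2l.
  by rewrite mem_enum inE => /andP[].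
by rewrite addKn; set r := map _ _; have := mem_bitseqs r; rewrite size_map size_iota.
Qed.

Theorem card_leq_keys S : 3 <= #|S| -> #|S| <= #|keys S|.
Proof.
have [n] := ubnP #|S|; elim: n S => // n IH S leSn S3.
(* With 3 points settled directly, deleting a twin leaves at least 3. *)
have [S4|S4] := leqP #|S| 3; first by apply: card_keys_small; rewrite S3 leqW.
have [/exists_inP[y yS /exists_inP[z zS /and3P[yz eyz /forall_inP tw]]]|notwins] :=
  boolP [exists y in S, exists z in S, [&& y != z, ~~ e y z &
     [forall v in S, (v != y) ==> (v != z) ==> (e v y == e v z)]]].
  have cardS : #|S| = #|S :\ z|.+1 by rewrite (cardsD1 z) zS.
  rewrite cardS; apply: leq_ltn_trans (card_keys_del_twin yS zS yz eyz _).
    by move: leSn S4; rewrite cardS !ltnS; apply: IH.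
  by move=> v vS vy vz; have := tw v vS; rewrite vy vz => /eqP.
apply: card_keys_twin_free => // y z yS zS yz eyz.
move: notwins; rewrite negb_exists_in => /forall_inP/(_ y yS).
rewrite negb_exists_in => /forall_inP/(_ z zS); rewrite yz eyz /=.
rewrite negb_forall_in => /exists_inP[v vS]; rewrite !negb_imply => /and3P[? ? ?].
by exists v.
Qed.

End Graph.

(** * From metric spaces to graphs *)

Section OneTwoMetric.

Context (R : realType) (M : finMetricType R).
Context (hdist : forall x y : M, (mdist x y \in [:: 0; 1; 2 : R])%R).

Definition unit_dist : rel M := fun x y => mdist x y == 1%R.

Lemma unit_dist_sym : symmetric unit_dist.
Proof. by move=> x y; rewrite /unit_dist metric_sym. Qed.

Lemma mdist_unit_dist (x y : M) :
  mdist x y = ((if x == y then 0 else if unit_dist x y then 1 else 2)%:R)%R.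
Proof.
have [->|xy] := eqVneq x y; first exact: mdistxx.
rewrite /unit_dist; case: eqP => // d1; have := hdist x y.
rewrite !inE => /or3P[/eqP d0|/eqP //|/eqP //].
by case/eqP: xy; apply: mdist_positivity; rewrite d0.
Qed.

(** For [z] outside the pair, both distances to [z] are 1 or 2. If the pair is at distance 1, only
    the difference can match, when exactly one of them is 1; at distance 2, only the sum can, when
    both are 1. *)
Lemma line_unit_dist (x y : M) : x != y -> line x y = line_in unit_dist setT x y.
Proof.
move=> xy; apply/setP=> z; rewrite !inE /= /on_line.
rewrite !mdist_unit_dist (negPf xy) [unit_dist z y]unit_dist_sym.
rewrite -GRing.natrD -[(_ - _)%R]GRing.opprB Num.Theory.normrN.
have dist_nat (m n : nat) : `|m%:R - n%:R|%R = ((m - n) + (n - m))%:R%R :> R.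
  have [le_mn|/ltnW le_nm] := leqP m n.
    rewrite (eqP le_mn) add0n GRing.natrB // -GRing.opprB Num.Theory.normrN.
    by rewrite Num.Theory.ger0_norm // Num.Theory.subr_ge0 Num.Theory.ler_nat.
  rewrite (eqP le_nm) addn0 GRing.natrB //.
  by rewrite Num.Theory.ger0_norm // Num.Theory.subr_ge0 Num.Theory.ler_nat.
rewrite dist_nat !Num.Theory.eqr_nat [x == z]eq_sym.
have [->|zx] := eqVneq z x.
  by rewrite (negPf xy) !add0n [unit_dist y x]unit_dist_sym eqxx.
have [->|zy] := eqVneq z y; first by rewrite addn0 ?eqxx ?orbT.
by case: (unit_dist x y); case: (unit_dist x z); case: (unit_dist y z).
Qed.

(** Each key is a nonuniversal line tagged with [set0] or a universal pair tagged with [setT]. *)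
Lemma card_keys_leq :
  #|keys unit_dist setT| <= num_nonuniversal_lines M + num_universal_pairs M.
Proof.
apply: (@leq_trans #|[set (L, set0) | L in nonuniversal_lines M] :|:
                    [set (setT, U) | U in universal_pairs M]|); last first.
  by apply: leq_trans (leq_card_setU _ _) _; rewrite leq_add ?leq_imset_card.
apply/subset_leq_card/subsetP=> _ /imsetP[[x y] + ->]; rewrite !inE /= => xy.
rewrite /key /= -line_unit_dist //; case: ifP => [univ|nuniv].
  apply/orP; right; rewrite (eqP univ); apply: imset_f.
  by apply/imsetP; exists (x, y); rewrite // inE /= xy univ.
apply/orP; left; apply: (imset_f (fun L => (L, set0))).
rewrite inE nuniv andbT; apply/imsetP.
by exists (x, y); rewrite ?inE.
Qed.

End OneTwoMetric.

Local Open Scope ring_scope.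

Theorem theorem4 (R : realType) (M : finMetricType R)
  (hdist : forall x y : M, mdist x y \in [:: 0; 1; 2 : R])
  (hcard : (3 <= #|M|)%N) :
  (num_nonuniversal_lines M + num_universal_pairs M >= #|M|)%N.
Proof.
apply: leq_trans (card_keys_leq hdist); rewrite -cardsT.
by apply: (card_leq_keys (unit_dist_sym (M := M))); rewrite cardsT.
Qed.
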